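(* Let $\mathcal{H}(p,\mathbf{s})\subset\mathsf{E}$ be a crooked halfspace. Then the collection of all future-pointing unit-timelike vectors parallel to a particle contained in $\mathcal{H}(p,\mathbf{s})$ is the halfplane $\mathfrak{h}(\mathbf{s})\subset\mathsf{H}^2$.
   Context: $\mathsf{V}$ is an oriented real $3$-dimensional vector space with an inner product $\mathbf{u}\cdot\mathbf{v}$ of signature $(2,1)$ and a chosen time-orientation: one of the two components of the set of timelike vectors ($\mathbf{v}\cdot\mathbf{v}<0$) is selected and called $\mathsf{Future}$. A nonzero non-spacelike vector is future-pointing if it lies in the closure of $\mathsf{Future}$. $\mathsf{E}$ (Minkowski space) is an affine space with group of translations $\mathsf{V}$. A vector $\mathbf{s}$ is unit-spacelike if $\mathbf{s}\cdot\mathbf{s}=1$. For such $\mathbf{s}$, $\mathbf{s}^-,\mathbf{s}^+\in\mathbf{s}^\perp$ denote future-pointing null vectors with $\mathbf{s}^-\cdot\mathbf{s}^+=-1$ such that $(\mathbf{s},\mathbf{s}^-,\mathbf{s}^+)$ is a positively oriented basis of $\mathsf{V}$. For $p\in\mathsf{E}$ and $\mathbf{s}$ unit-spacelike, the (open) crooked halfspace with vertex $p$ and director $\mathbf{s}$ is $$\mathcal{H}(p,\mathbf{s})=\{q: (q-p)\cdot\mathbf{s}^+<0,\ (q-p)\cdot\mathbf{s}>0\}\cup\{q:(q-p)\cdot\mathbf{s}^+<0,\ (q-p)\cdot\mathbf{s}^->0,\ (q-p)\cdot\mathbf{s}=0\}\cup\{q:(q-p)\cdot\mathbf{s}^->0,\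 (q-p)\cdot\mathbf{s}<0\}.$$ A particle is an affine line $q+\mathbb{R}\mathbf{v}$ with $\mathbf{v}$ timelike. A vector is unit-timelike if $\mathbf{v}\cdot\mathbf{v}=-1$. The hyperbolic plane is $\mathsf{H}^2=\{\mathbf{v}\in\mathsf{Future}:\mathbf{v}\cdot\mathbf{v}=-1\}$, and the halfplane determined by a spacelike vector $\mathbf{s}$ is $\mathfrak{h}(\mathbf{s})=\{\mathbf{v}\in\mathsf{H}^2:\mathbf{v}\cdot\mathbf{s}\ge0\}$.
   Formalization: As stated, the claim fails for v in h(s) with v·s = 0: no particle in the open crooked halfspace is parallel to v. Proved instead: the open crooked halfspace gives h(s) minus its boundary geodesic (v·s > 0), and the closure of the crooked halfspace gives exactly h(s). *)

(* Defs.v *)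
From HB Require Import structures.
From mathcomp Require Import all_boot all_order all_algebra.
From mathcomp Require Import sesquilinear.
From mathcomp Require Import all_classical all_reals all_analysis.

Set Implicit Arguments.
Unset Strict Implicit.
Unset Printing Implicit Defensive.

Import Order.TTheory GRing.Theory Num.Theory.
Import numFieldNormedType.Exports.

Local Open Scope classical_set_scope.
Local Open Scope ring_scope.

(* A vectType carries no topology: the topology of a 3-dimensional real vector
   space is the one transported from 'rV[R]_3 by the coordinates in any basis,
   and does not depend on that basis. *)
Definition coords (R : realType) (V : vectType R) (e : 3.-tuple V) (v : V) :
  'rV[R]_3 := \row_(i < 3) coord e i v.

Definition orthogonal_basis_21 (R : realType) (V : vectType R)
    (dot : V -> V -> R) (b : 3.-tuple V) : Prop :=
  basis_of fullv b /\
  forall i j : 'I_3, dot (tnth b i) (tnth b j) =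
    if i == j then (if (i < 2)%N then 1 else -1) else 0.

(* An orientation is a class of ordered bases, given here by a representative
   [refbasis]. The time-orientation is [Future]. *)
Record lorentzSpace (R : realType) := LorentzSpace {
  lvect :> vectType R;
  dot : {bilinear lvect -> lvect -> R | *%R & *%R};
  dotC : forall u v : lvect, dot u v = dot v u;
  signature_21 : exists b : 3.-tuple lvect, orthogonal_basis_21 dot b;
  refbasis : 3.-tuple lvect;
  refbasisP : basis_of fullv refbasis;
  Future : set lvect;
  FutureP : exists2 u : lvect, dot u u < 0 &
    Future = [set v | connected_component
                        (coords refbasis @` [set w | dot w w < 0])
                        (coords refbasis u) (coords refbasis v)] }.

Definition vclosure (R : realType) (V : lorentzSpace R) (A : set V) : set V :=
  [set v | closure (coords (refbasis V) @` A) (coords (refbasis V) v)].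

Definition timelike (R : realType) (V : lorentzSpace R) (v : V) : Prop :=
  dot V v v < 0.

Definition unit_timelike (R : realType) (V : lorentzSpace R) (v : V) : Prop :=
  dot V v v = -1.

Definition unit_spacelike (R : realType) (V : lorentzSpace R) (v : V) : Prop :=
  dot V v v = 1.

Definition null_vector (R : realType) (V : lorentzSpace R) (v : V) : Prop :=
  v != 0 /\ dot V v v = 0.

Definition future_pointing (R : realType) (V : lorentzSpace R) (v : V) : Prop :=
  [/\ v != 0, dot V v v <= 0 & vclosure (@Future R V) v].

Definition positively_oriented (R : realType) (V : lorentzSpace R)
    (u v w : V) : Prop :=
  0 < \det (\matrix_(i < 3, j < 3)
              coord (refbasis V) j (tnth [tuple u; v; w] i)).

(* [sm] and [sp] play the roles of s^- and s^+, which [s] determines only up to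
   (sm, sp) |-> (c *: sm, c^-1 *: sp) with c > 0. *)
Definition null_frame (R : realType) (V : lorentzSpace R)
    (s sm sp : V) : Prop :=
  [/\ unit_spacelike s,
      [/\ null_vector sm, future_pointing sm & dot V sm s = 0],
      [/\ null_vector sp, future_pointing sp & dot V sp s = 0],
      dot V sm sp = -1 &
      positively_oriented s sm sp].

Record affineSpace (R : realType) (V : lorentzSpace R) := AffineSpace {
  point :> Type;
  translate : point -> V -> point;
  vdiff : point -> point -> V;
  translate0 : forall p, translate p 0 = p;
  translateD : forall p u v,
    translate p (u + v) = translate (translate p u) v;
  translateK : forall p v, vdiff (translate p v) p = v;
  vdiffK : forall q p, translate p (vdiff q p) = q }.

Definition aclosure (R : realType) (V : lorentzSpace R) (E : affineSpace V)
    (A : set E) : set E :=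
  [set q | vclosure [set vdiff r q | r in A] 0].

Definition crooked_halfspace (R : realType) (V : lorentzSpace R)
    (E : affineSpace V) (p : E) (s sm sp : V) : set E :=
  [set q | dot V (vdiff q p) sp < 0 /\ dot V (vdiff q p) s > 0] `|`
  [set q | [/\ dot V (vdiff q p) sp < 0, dot V (vdiff q p) sm > 0 &
               dot V (vdiff q p) s = 0]] `|`
  [set q | dot V (vdiff q p) sm > 0 /\ dot V (vdiff q p) s < 0].

Definition line (R : realType) (V : lorentzSpace R) (E : affineSpace V)
    (q : E) (v : V) : set E :=
  [set translate q (t *: v) | t in [set: R]].

Definition particle (R : realType) (V : lorentzSpace R) (E : affineSpace V)
    (L : set E) : Prop :=
  exists q v, timelike v /\ L = line q v.

Definition parallel (R : realType) (V : lorentzSpace R) (E : affineSpace V)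
    (w : V) (L : set E) : Prop :=
  w != 0 /\ exists a b, [/\ L a, L b & vdiff b a = w].

Definition particle_directions (R : realType) (V : lorentzSpace R)
    (E : affineSpace V) (A : set E) : set V :=
  [set w | [/\ future_pointing w, unit_timelike w &
               exists L, [/\ particle L, L `<=` A & parallel w L]]].

Definition hyperbolic_plane (R : realType) (V : lorentzSpace R) : set V :=
  [set v | Future v /\ dot V v v = -1].

Definition halfplane (R : realType) (V : lorentzSpace R) (s : V) : set V :=
  [set v | hyperbolic_plane v /\ 0 <= dot V v s].

Definition boundary_geodesic (R : realType) (V : lorentzSpace R) (s : V) :
  set V := [set v | hyperbolic_plane v /\ dot V v s = 0].

(* Main.v *)
(* Write v = x s - y sm - z sp with x = v . s, y = v . sp, z = v . sm, so that
   v . v = x^2 - 2 y z and v . w = x x' - y z' - z y'. By a reverse Cauchy-Schwarz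
   inequality the two nappes of the timelike cone are told apart by the sign of
   the product with a fixed timelike vector, and future timelike vectors have
   y < 0 and z < 0. Along a particle with future direction w, (q - p) . sp and
   (q - p) . sm therefore decrease from +oo to -oo. If w . s < 0 the particle
   ends up with (q - p) . s < 0 and (q - p) . sm < 0, outside the closed
   halfspace; if w . s > 0 the particle through p + sm - sp stays in the open
   halfspace; if w . s = 0 no particle stays in the open halfspace, whereas the
   one through p stays in its closure. *)
Require Import Defs.
From mathcomp Require Import all_boot all_order all_algebra.
From mathcomp Require Import all_classical all_reals all_analysis.
From mathcomp Require Import sesquilinear lra ring.

Import Order.TTheory GRing.Theory Num.Theory.
Import numFieldNormedType.Exports.

Local Open Scope classical_set_scope.
Local Open Scope ring_scope.

Set Implicit Arguments.
Unset Strict Implicit.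
Unset Printing Implicit Defensive.

(** * Bilinear form in a null frame *)

Lemma dotDl (R : realType) (V : lorentzSpace R) (u v w : V) :
  dot V (u + v) w = dot V u w + dot V v w.
Proof. exact: linearDl. Qed.

Lemma dotZl (R : realType) (V : lorentzSpace R) (a : R) (u w : V) :
  dot V (a *: u) w = a * dot V u w.
Proof. exact: linearZl_LR. Qed.

Lemma dotDr (R : realType) (V : lorentzSpace R) (u v w : V) :
  dot V w (u + v) = dot V w u + dot V w v.
Proof. exact: linearDr. Qed.

Lemma dotZr (R : realType) (V : lorentzSpace R) (a : R) (u w : V) :
  dot V w (a *: u) = a * dot V w u.
Proof. exact: linearZr_LR. Qed.

Lemma dot0r (R : realType) (V : lorentzSpace R) (w : V) : dot V w 0 = 0.
Proof. exact: linear0r. Qed.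

(** Pairing with the frame vectors shows that they are free, hence a basis; the formula records the
    Gram matrix of that basis. *)
Lemma dot_null_frame (R : realType) (V : lorentzSpace R) (s sm sp : V) :
  null_frame s sm sp -> forall v w,
  dot V v w = dot V v s * dot V w s - dot V v sp * dot V w sm
              - dot V v sm * dot V w sp.
Proof.
move=> [ss [[_ mm] _ ms] [[_ pp] _ ps] mp _] v w.
have sm0 : dot V s sm = 0 by rewrite dotC.
have sp0 : dot V s sp = 0 by rewrite dotC.
have pm : dot V sp sm = -1 by rewrite dotC.
pose X := [tuple s; sm; sp].
have gram k : \sum_(i < 3) k i *: X`_i
    = k ord0 *: s + k (inord 1) *: sm + k (inord 2) *: sp.
  rewrite !big_ord_recr big_ord0 /= add0r.
  congr (_ *: _ + _ *: _ + _ *: _); congr k; apply/val_inj => //=;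
    by rewrite inordK.
have bX : basis_of fullv X.
  rewrite basisEfree subvf /= -(span_basis (refbasisP V)).
  rewrite (leq_trans (dim_span _)) ?size_tuple // andbT.
  apply/freeP => k; rewrite gram => k0.
  have k00 : k ord0 = 0.
    by have := congr1 (dot V s) k0; rewrite !dotDr !dotZr dot0r ss sm0 sp0; lra.
  (* [sm] and [sp] are null and dual up to sign, so pairing with one isolates the coefficient of the
     other. *)
  have k01 : k (inord 1) = 0.
    by have := congr1 (dot V sp) k0; rewrite !dotDr !dotZr dot0r ps pm pp; lra.
  have k02 : k (inord 2) = 0.
    by have := congr1 (dot V sm) k0; rewrite !dotDr !dotZr dot0r ms mm mp; lra.
  move=> i; have [|[|]] : i = ord0 \/ i = inord 1 \/ i = inord 2.
  - case: i => [[|[|[|i]]]] // hi; [left|right; left|right; right];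
      by apply/val_inj; rewrite //= inordK.
  - by move=> ->.
  - by move=> ->.
  - by move=> ->.
rewrite (coord_basis bX (memvf v)) (coord_basis bX (memvf w)) !gram.
rewrite !(dotDl, dotDr, dotZl, dotZr) ss ms mm ps pp mp sm0 sp0 pm.
ring.
Qed.

(** * Timelike vectors in null coordinates *)

(** [x * x < 2 * (y * z)] is timelikeness in null coordinates. In case of equality, multiplying the
    two hypotheses would give [(y z' + z y')^2 < 4 y z y' z'], against [(y z' - z y')^2 >= 0]. *)
Lemma timelike_pairing_neq0 (R : realType) (x y z x' y' z' : R) :
  x * x < 2 * (y * z) -> x' * x' < 2 * (y' * z') ->
  x * x' != y * z' + z * y'.
Proof.
move=> h h'; apply/eqP => e.
have hh : (x * x) * (x' * x') < (2 * (y * z)) * (2 * (y' * z')).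
  by apply: ltr_pM => //; rewrite -expr2 sqr_ge0.
have := sqr_ge0 (y * z' - z * y').
have -> : (y * z' - z * y') ^+ 2
  = (y * z' + z * y') ^+ 2 - (2 * (y * z)) * (2 * (y' * z')) by ring.
rewrite -e.
have -> : (x * x') ^+ 2 = (x * x) * (x' * x') by ring.
lra.
Qed.

(** [h'] forces [y'] and [z'] to have the same sign. If both were positive, squaring
    [x x' < y z' + z y' < 0] would contradict the same inequality of squares. *)
Lemma timelike_same_nappe (R : realType) (x y z x' y' z' : R) :
  x * x < 2 * (y * z) -> x' * x' < 2 * (y' * z') ->
  x * x' - y * z' - z * y' < 0 -> y < 0 -> z < 0 -> y' < 0 /\ z' < 0.
Proof.
move=> h h' e y0 z0.
have hh : (x * x) * (x' * x') < (2 * (y * z)) * (2 * (y' * z')).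
  by apply: ltr_pM => //; rewrite -expr2 sqr_ge0.
have yz' : 0 < y' * z' by have := sqr_ge0 x'; rewrite expr2; lra.
have [y'0|y'0|y'0] := ltgtP y' 0; last by rewrite y'0 mul0r ltxx in yz'.
  by split=> //; rewrite -(nmulr_rgt0 _ y'0).
have z'0 : 0 < z' by rewrite -(pmulr_rgt0 _ y'0).
have S0 : y * z' + z * y' < 0.
  by rewrite -oppr_gt0 opprD addr_gt0 // oppr_gt0 nmulr_rlt0.
have : (y * z' + z * y') ^+ 2 < (x * x') ^+ 2.
  by rewrite -sqrrN -[ltRHS]sqrrN ltr_pXn2r ?nnegrE //; lra.
have := sqr_ge0 (y * z' - z * y').
have -> : (y * z' - z * y') ^+ 2
  = (y * z' + z * y') ^+ 2 - (2 * (y * z)) * (2 * (y' * z')) by ring.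
have -> : (x * x') ^+ 2 = (x * x) * (x' * x') by ring.
lra.
Qed.

Lemma timelike_dot_neq0 (R : realType) (V : lorentzSpace R) (s sm sp : V) :
  null_frame s sm sp ->
  forall u v, timelike u -> timelike v -> dot V u v != 0.
Proof.
move=> hs u v; rewrite /timelike (dot_null_frame hs u u).
rewrite (dot_null_frame hs v v) (dot_null_frame hs u v) => hu hv.
have := @timelike_pairing_neq0 _ (dot V u s) (dot V u sp) (dot V u sm)
  (dot V v s) (dot V v sp) (dot V v sm) ltac:(lra) ltac:(lra).
by apply: contra_neq; lra.
Qed.

(** * Topology through coordinates *)

Lemma coordsD (R : realType) (V : lorentzSpace R) (u v : V) :
  coords (refbasis V) (u + v)
  = coords (refbasis V) u + coords (refbasis V) v.
Proof. by apply/rowP => i; rewrite !mxE linearD. Qed.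

Lemma coordsZ (R : realType) (V : lorentzSpace R) (a : R) (v : V) :
  coords (refbasis V) (a *: v) = a *: coords (refbasis V) v.
Proof. by apply/rowP => i; rewrite !mxE linearZ. Qed.

(** The form [dot V u] moved to coordinate rows, where continuity makes sense. *)
Definition dot_coords (R : realType) (V : lorentzSpace R) (u : V)
  (x : 'rV[R]_3) : R := \sum_(i < 3) x ord0 i * dot V u (refbasis V)`_i.

Lemma dot_coordsE (R : realType) (V : lorentzSpace R) (u v : V) :
  dot_coords u (coords (refbasis V) v) = dot V u v.
Proof.
rewrite [in RHS](coord_basis (refbasisP V) (memvf v)) linear_sumr.
by apply: eq_bigr => i _; rewrite mxE dotZr.
Qed.

Lemma dot_coords_continuous (R : realType) (V : lorentzSpace R) (u : V) :
  continuous (dot_coords u).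
Proof.
have dE : dot_coords u = (fun x => x ord0 ord0 * dot V u (refbasis V)`_0
    + x ord0 (inord 1) * dot V u (refbasis V)`_1
    + x ord0 (inord 2) * dot V u (refbasis V)`_2).
  apply/funext => x; rewrite /dot_coords !big_ord_recr big_ord0 /= add0r.
  by congr (x _ _ * _ + x _ _ * _ + x _ _ * _); apply/val_inj;
    rewrite //= inordK.
move=> x; rewrite dE.
by apply: (@cvgD R R^o _ (nbhs x)); [apply: (@cvgD R R^o _ (nbhs x))|];
  apply: cvgMr_tmp; exact: coord_continuous.
Qed.

Lemma coords_affine_continuous (R : realType) (V : lorentzSpace R) (u v : V) :
  continuous (fun t : R => coords (refbasis V) (u + t *: v) : 'rV[R]_3).
Proof.
under eq_fun do rewrite coordsD coordsZ.
move=> t; apply: cvgD; first exact: cvg_cst.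
exact: cvgZr_tmp.
Qed.

(** Two strict linear inequalities cut out an open set. They are imposed together because leaving
    the halfspace is detected by a pair of signs. *)
Lemma vclosure_approx (R : realType) (V : lorentzSpace R) (A : set V)
    (v k1 k2 : V) (c1 c2 : R) :
  vclosure A v -> dot V k1 v < c1 -> dot V k2 v < c2 ->
  exists r, [/\ A r, dot V k1 r < c1 & dot V k2 r < c2].
Proof.
rewrite -!dot_coordsE => clA k1v k2v.
have [|_ [[r Ar <-] [/= h1 h2]]] := clA
  ((dot_coords k1 @^-1` [set x | x < c1]) `&`
   (dot_coords k2 @^-1` [set x | x < c2])).
  by apply: filterI; apply: dot_coords_continuous; exact: lt_nbhsl.
by exists r; split; rewrite // -dot_coordsE.
Qed.

Lemma vclosure_ray (R : realType) (V : lorentzSpace R) (A : set V) (v d : V) :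
  (forall t : R, 0 < t -> A (v + t *: d)) -> vclosure A v.
Proof.
move=> Ad B; have := @coords_affine_continuous R V v d 0.
rewrite /continuous_at scale0r addr0 => cv /cv /nbhs_ballP[e /= e0 eB].
exists (coords (refbasis V) (v + (e / 2) *: d)); split.
  by exists (v + (e / 2) *: d) => //; apply: Ad; rewrite divr_gt0.
by apply: eB; rewrite /ball /= sub0r normrN gtr0_norm; lra.
Qed.

(** * The future cone and the hyperbolic plane *)

(* On a connected set of timelike vectors the sign of the product with a fixed
   timelike vector is constant; conversely, two timelike vectors with negative
   product are joined by a segment of timelike vectors. *)
Lemma FutureE (R : realType) (V : lorentzSpace R) (s sm sp : V) :
  null_frame s sm sp ->
  exists2 u : V, timelike u &
    forall v, @Future R V v <-> timelike v /\ dot V u v < 0.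
Proof.
move=> hs; have [u u0 ->] := FutureP V; exists u => // v; split=> /=.
  move=> [C [Cu CT cC] Cv].
  have [w wT wv] := CT _ Cv.
  (* [wv] only equates coordinates, but these determine every product. *)
  have vT : timelike v.
    have e x : dot V x v = dot V x w by rewrite -!dot_coordsE wv.
    by rewrite /timelike e dotC e.
  split=> //; rewrite ltNge; apply/negP => uv.
  have /connected_intervalP iC : connected (dot_coords u @` C).
    apply: connected_continuous_connected => //.
    exact/continuous_subspaceT/dot_coords_continuous.
  (* The image of [C] is an interval with a negative and a nonnegative point, so it contains 0,
     which no timelike vector yields. *)
  have [|||x Cx x0] := iC (dot V u u) (dot V u v) _ _ 0.
  - by exists (coords (refbasis V) u) => //; rewrite dot_coordsE.
  - by exists (coords (refbasis V) v) => //; rewrite dot_coordsE.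
  - by rewrite uv ltW.
  have [y yT yx] := CT _ Cx.
  have := timelike_dot_neq0 hs u0 yT.
  by rewrite -dot_coordsE yx x0 eqxx.
move=> [vT uv].
pose f (t : R) : 'rV[R]_3 := coords (refbasis V) (u + t *: (v - u)).
exists (f @` `[0, 1]); last first.
  by exists 1; rewrite /= ?in_itv /= ?ler01 ?lexx // /f scale1r addrC subrK.
split.
- by exists 0; rewrite /= ?in_itv /= ?ler01 ?lexx // /f scale0r addr0.
- move=> _ [t /= t01 <-]; exists (u + t *: (v - u)) => //=.
  have -> : u + t *: (v - u) = (1 - t) *: u + t *: v.
    by rewrite scalerBr scalerBl scale1r addrA addrAC.
  move: t01; rewrite in_itv /= => /andP[t0 t1].
  rewrite !(dotDl, dotDr, dotZl, dotZr) (dotC v u).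
  move: vT u0; rewrite /timelike => vT u0.
  (* At [t = 0] strictness comes from [u], otherwise from the term in [v]. *)
  have [->|tn0] := eqVneq t 0; first by lra.
  have tp : 0 < t by rewrite lt_def tn0.
  have h1 : t * (t * dot V v v) < 0 by rewrite !pmulr_rlt0.
  have h2 : (1 - t) * ((1 - t) * dot V u u) <= 0.
    by rewrite !mulr_ge0_le0 //; lra.
  have h3 : (1 - t) * (t * dot V u v) <= 0.
    by rewrite !mulr_ge0_le0 //; lra.
  lra.
- apply: connected_continuous_connected; first exact: segment_connected.
  exact/continuous_subspaceT/coords_affine_continuous.
Qed.

(** Closure only preserves [dot V u w <= 0]; strictness returns because timelike vectors never pair
    to zero. *)
Lemma future_unit_timelikeE (R : realType) (V : lorentzSpace R)
    (s sm sp w : V) : null_frame s sm sp ->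
  (future_pointing w /\ unit_timelike w) <-> @hyperbolic_plane R V w.
Proof.
move=> hs; have [u uT FE] := FutureE hs.
split=> [[[w0 _ clw] w1]|[Fw w1]].
  have wT : timelike w by rewrite /timelike w1 ltrN10.
  split=> //; apply/FE; split=> //.
  rewrite lt_neqAle (timelike_dot_neq0 hs) //=.
  rewrite leNgt; apply/negP => uw.
  have uw' : dot V (- u) w < 0 by rewrite -scaleN1r dotZl; lra.
  (* A single inequality is wanted, so the same form fills both slots. *)
  have [r [/FE[_ ur] + _]] := vclosure_approx clw uw' uw'.
  by rewrite -scaleN1r dotZl; lra.
split=> //; split.
- by apply: contra_eq_neq w1 => ->; rewrite dot0r eq_sym oppr_eq0 oner_eq0.
- by rewrite w1; lra.
- exact/subset_closure/imageP.
Qed.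

(** Membership of [sm] in the closure of [Future] fixes its sign against [u]; timelikeness of [u]
    gives [sp] the same sign, and the nappe argument carries both signs from [u] to [w]. *)
Lemma hyperbolic_plane_dot_null (R : realType) (V : lorentzSpace R)
    (s sm sp w : V) : null_frame s sm sp ->
  @hyperbolic_plane R V w -> dot V w sm < 0 /\ dot V w sp < 0.
Proof.
move=> hs [Fw _]; have [u uT FE] := FutureE hs.
have [_ [_ [_ _ clm] _] _ _ _] := hs.
have um : dot V u sm <= 0.
  rewrite leNgt; apply/negP => um.
  have um' : dot V (- u) sm < 0 by rewrite -scaleN1r dotZl; lra.
  have [r [/FE[_ ur] + _]] := vclosure_approx clm um' um'.
  by rewrite -scaleN1r dotZl; lra.
have /FE[wT uw] := Fw.
move: uT wT uw; rewrite /timelike (dot_null_frame hs u u).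
rewrite (dot_null_frame hs w w) (dot_null_frame hs u w) => uT wT uw.
have yz : 0 < dot V u sp * dot V u sm.
  by have := sqr_ge0 (dot V u s); rewrite expr2; lra.
have um0 : dot V u sm < 0.
  by rewrite lt_neqAle um andbT; apply: contraTneq yz => ->; rewrite mulr0 ltxx.
have up0 : dot V u sp < 0 by rewrite -(nmulr_lgt0 _ um0).
have [] := @timelike_same_nappe _ (dot V u s) (dot V u sp) (dot V u sm)
  (dot V w s) (dot V w sp) (dot V w sm); by [lra | split].
Qed.

(** * Affine lines, particles and closures *)

Lemma vdiff_translate (R : realType) (V : lorentzSpace R) (E : affineSpace V)
    (p q : E) (v : V) : vdiff (translate q v) p = vdiff q p + v.
Proof. by rewrite -{1}(vdiffK q p) -translateD translateK. Qed.

Lemma vdiffpp (R : realType) (V : lorentzSpace R) (E : affineSpace V) (p : E) :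
  vdiff p p = 0.
Proof. by rewrite -{1}(translate0 p) translateK. Qed.

(** A vector parallel to a particle is a nonzero multiple of its direction, so the line can be
    parametrised by [w] itself. *)
Lemma particle_in_timelike_direction (R : realType) (V : lorentzSpace R)
    (E : affineSpace V) (A : set E) (w : V) : timelike w ->
  (exists L, [/\ particle L, L `<=` A & parallel w L]) <->
  exists q : E, forall t : R, A (translate q (t *: w)).
Proof.
move=> wT; have w0 : w != 0.
  by apply: contraTneq wT => ->; rewrite /timelike dot0r ltxx.
split=> [[_ [[q [v [vT ->]]] LA [_ [_ [_ [[a _ <-] [b _ <-] abw]]]]]]|[q qA]].
  have {}abw : (b - a) *: v = w.
    rewrite -abw scalerBl -[in RHS](subrKC (a *: v) (b *: v)).
    by rewrite translateD translateK.
  have ba0 : b - a != 0.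
    by apply: contra_neq w0 => ba0; rewrite -abw ba0 scale0r.
  exists q => t; apply: LA; exists (t * (b - a)) => //.
  by rewrite -abw scalerA.
exists (line q w); split.
- by exists q, w.
- by move=> _ [t _ <-].
- split=> //; exists q, (translate q w); split.
  + by exists 0 => //; rewrite scale0r translate0.
  + by exists 1 => //; rewrite scale1r.
  + exact: translateK.
Qed.

Lemma particle_directionsE (R : realType) (V : lorentzSpace R)
    (E : affineSpace V) (A : set E) (s sm sp w : V) : null_frame s sm sp ->
  particle_directions A w <-> @hyperbolic_plane R V w /\
    exists q : E, forall t : R, A (translate q (t *: w)).
Proof.
move=> hs; split=> [[fw w1 LA]|[hw qA]].
  split; first exact/(future_unit_timelikeE w hs).
  apply/(particle_in_timelike_direction _ _).1 => //.
  by rewrite /timelike w1 ltrN10.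
have [fw w1] := (future_unit_timelikeE w hs).2 hw.
split=> //; apply/(particle_in_timelike_direction _ _).2 => //.
by rewrite /timelike w1 ltrN10.
Qed.

Lemma subset_aclosure (R : realType) (V : lorentzSpace R) (E : affineSpace V)
  (A : set E) : A `<=` aclosure A.
Proof.
move=> q Aq; apply: subset_closure; apply: imageP.
by exists q => //; exact: vdiffpp.
Qed.

Lemma aclosure_ray (R : realType) (V : lorentzSpace R) (E : affineSpace V)
    (A : set E) (q : E) (d : V) :
  (forall t : R, 0 < t -> A (translate q (t *: d))) -> aclosure A q.
Proof.
move=> Ad; apply: (vclosure_ray (d := d)) => t t0.
by exists (translate q (t *: d)); [exact: Ad | rewrite translateK add0r].
Qed.

(** * Particles and the crooked halfspace *)

Lemma affine_pos_eventually (R : realType) (a b c d : R) : 0 < b -> 0 < d ->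
  exists t : R, 0 < a + t * b /\ 0 < c + t * d.
Proof.
(* Each quotient absorbs one constant term; the summand 1 makes both inequalities strict. *)
move=> b0 d0; exists (`|a| / b + `|c| / d + 1).
have ab : `|a| / b * b = `|a| by rewrite divfK ?gt_eqF.
have cd : `|c| / d * d = `|c| by rewrite divfK ?gt_eqF.
have := ler_norm (- a); have := ler_norm (- c); rewrite !normrN => ha hc.
have h1 : 0 <= `|c| / d * b by rewrite mulr_ge0 ?divr_ge0 // ltW.
have h2 : 0 <= `|a| / b * d by rewrite mulr_ge0 ?divr_ge0 // ltW.
by split; rewrite !mulrDl ?ab ?cd; lra.
Qed.

(** If [dot V w s < 0], some point of the particle pairs negatively with both [s] and [sm]. This
    open condition passes to nearby points, yet each of the three pieces excludes it. *)
Lemma particle_in_aclosure_dot_ge0 (R : realType) (V : lorentzSpace R)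
    (E : affineSpace V) (p q : E) (s sm sp w : V) : null_frame s sm sp ->
  @hyperbolic_plane R V w ->
  (forall t : R,
     aclosure (crooked_halfspace p s sm sp) (translate q (t *: w))) ->
  0 <= dot V w s.
Proof.
move=> hs hw qH; rewrite leNgt; apply/negP => ws.
have [wm wp] := hyperbolic_plane_dot_null hs hw.
pose a := vdiff q p.
have [t [h1 h2]] := @affine_pos_eventually R (- dot V a s) (- dot V w s)
  (- dot V a sm) (- dot V w sm) ltac:(lra) ltac:(lra).
(* The bounds are what a displacement [r] may add before either sign changes. *)
have := @vclosure_approx R V _ 0 s sm (- dot V a s - t * dot V w s)
  (- dot V a sm - t * dot V w sm) (qH t).
rewrite !dot0r => /(_ ltac:(lra) ltac:(lra)) [r [[x Hx <-]]].
have xE : vdiff x p = vdiff x (translate q (t *: w)) + a + t *: w.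
  rewrite -{1}(vdiffK x (translate q (t *: w))) !vdiff_translate -/a.
  by rewrite addrC addrA.
rewrite (dotC s) (dotC sm).
move: (vdiff x (translate q (t *: w))) xE => r' xE r1 r2.
have xs : dot V (vdiff x p) s < 0 by rewrite xE !dotDl dotZl; lra.
have xm : dot V (vdiff x p) sm < 0 by rewrite xE !dotDl dotZl; lra.
by case: Hx => [[[_]|[_ _]]|[]]; lra.
Qed.

(** If [dot V w s = 0], the product with [s] is constant along the particle. Early points violate
    the condition on [sp], late ones that on [sm], and whatever the constant, one of the two is
    required throughout. *)
Lemma particle_in_crooked_halfspace_dot_neq0 (R : realType)
    (V : lorentzSpace R) (E : affineSpace V) (p q : E) (s sm sp w : V) :
  null_frame s sm sp -> @hyperbolic_plane R V w ->
  (forall t : R, crooked_halfspace p s sm sp (translate q (t *: w))) ->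
  dot V w s != 0.
Proof.
move=> hs hw qH; apply/eqP => ws.
have [wm wp] := hyperbolic_plane_dot_null hs hw.
pose a := vdiff q p.
have [t [h1 h2]] := @affine_pos_eventually R (dot V a sp) (- dot V w sp)
  (- dot V a sm) (- dot V w sm) ltac:(lra) ltac:(lra).
have [t' [h1' h2']] := @affine_pos_eventually R (- dot V a sp) (- dot V w sp)
  (- dot V a sm) (- dot V w sm) ltac:(lra) ltac:(lra).
have := qH (- t); have := qH t'.
rewrite /crooked_halfspace /= !vdiff_translate -/a !dotDl !dotZl ws.
rewrite !mulr0 !addr0.
by case=> [[[? ?]|[? ? ?]]|[? ?]]; case=> [[[? ?]|[? ? ?]]|[? ?]]; lra.
Qed.

(** The base point lies in the middle piece, with products -1 with [sp] and 1 with [sm]; the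
    particle comes from the third piece and goes on into the first. *)
Lemma particle_in_crooked_halfspace (R : realType)
    (V : lorentzSpace R) (E : affineSpace V) (p : E) (s sm sp w : V) :
  null_frame s sm sp -> @hyperbolic_plane R V w -> 0 < dot V w s ->
  forall t : R, crooked_halfspace p s sm sp
    (translate (translate p (sm - sp)) (t *: w)).
Proof.
move=> hs hw ws t; have [wm wp] := hyperbolic_plane_dot_null hs hw.
have [_ [[_ mm] _ ms] [[_ pp] _ ps] mp _] := hs.
have pm : dot V sp sm = -1 by rewrite dotC.
rewrite /crooked_halfspace /= !vdiff_translate vdiffpp add0r.
rewrite -(scaleN1r sp) !(dotDl, dotZl) ms ps mm pp mp pm.
have [t0|t0|->] := ltgtP t 0.
- have h1 : t * dot V w s < 0 by rewrite nmulr_rlt0.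
  have h2 : 0 < t * dot V w sm by rewrite nmulr_rgt0.
  by right; split; lra.
- have h1 : 0 < t * dot V w s by rewrite pmulr_rgt0.
  have h2 : t * dot V w sp < 0 by rewrite pmulr_rlt0.
  by left; left; split; lra.
- by left; right; split; lra.
Qed.

Lemma particle_in_aclosure (R : realType)
    (V : lorentzSpace R) (E : affineSpace V) (p : E) (s sm sp w : V) :
  null_frame s sm sp -> @hyperbolic_plane R V w -> dot V w s = 0 ->
  forall t : R, aclosure (crooked_halfspace p s sm sp) (translate p (t *: w)).
Proof.
move=> hs hw ws t; have [wm wp] := hyperbolic_plane_dot_null hs hw.
have [ss [[_ mm] _ ms] [[_ pp] _ ps] mp _] := hs.
have sm0 : dot V s sm = 0 by rewrite dotC.
have sp0 : dot V s sp = 0 by rewrite dotC.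
have pm : dot V sp sm = -1 by rewrite dotC.
have [t0|t0] := leP 0 t.
(* Pushing along [s] enters the first piece; adding [sm] makes the product with [sp] negative even
   at [t = 0]. *)
- apply: (aclosure_ray (d := s + sm)) => e e0; left; left.
  have h : t * dot V w sp <= 0 by rewrite mulr_ge0_le0 // ltW.
  rewrite /= !vdiff_translate vdiffpp add0r !(dotDl, dotZl) ms mp ss sp0 ws.
  by split; lra.
(* The product with [sm] is already positive, so pushing along [- s] alone enters the third
   piece. *)
- apply: (aclosure_ray (d := - s)) => e e0; right.
  have h : 0 < t * dot V w sm by rewrite nmulr_rgt0.
  rewrite -scaleN1r /= !vdiff_translate vdiffpp add0r !(dotDl, dotZl).
  by rewrite ss sm0 ws; split; lra.
Qed.

(** [halfplane s] contains its boundary geodesic, whose directions occur only for the closure of the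
    halfspace; hence two equalities. *)
Theorem theorem5p4 (R : realType) (V : lorentzSpace R) (E : affineSpace V)
    (p : E) (s sm sp : V) (hs : null_frame s sm sp) :
  particle_directions (crooked_halfspace p s sm sp)
    = halfplane s `\` boundary_geodesic s /\
  particle_directions (aclosure (crooked_halfspace p s sm sp)) = halfplane s.
Proof.
split; apply/seteqP; split=> w.
- move=> /(particle_directionsE _ _ hs)[hw [q qH]]; split.
    split=> //; apply: (particle_in_aclosure_dot_ge0 (p := p) (q := q) hs) => //.
    by move=> t; exact/subset_aclosure/qH.
  by move=> [_ ws]; have /eqP := particle_in_crooked_halfspace_dot_neq0 hs hw qH.
- move=> [[hw ws] nws]; apply/(particle_directionsE _ _ hs); split=> //.
  exists (translate p (sm - sp)); apply: particle_in_crooked_halfspace => //.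
  rewrite lt_def ws andbT; apply/eqP => ws0; exact: nws.
- move=> /(particle_directionsE _ _ hs)[hw [q qH]]; split=> //.
  exact: particle_in_aclosure_dot_ge0 hs hw qH.
- move=> [hw ws]; apply/(particle_directionsE _ _ hs); split=> //.
  have [ws0|ws0] := eqVneq (dot V w s) 0.
    by exists p; exact: particle_in_aclosure.
  exists (translate p (sm - sp)) => t; apply: subset_aclosure.
  by apply: particle_in_crooked_halfspace; rewrite // lt_def ws0.
Qed.
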